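(* For every $C>0$ and every $0<\eta<1$ there exist compactly supported integrable functions $f$ and $g$ on $\mathbb{R}^2$ such that $$ |\langle \mathcal{M}_S f, g\rangle| > C\sum_{R\in\mathcal{S}} \langle |f|\rangle_R\,\langle |g|\rangle_R\,|R| $$ for all $\eta$-sparse collections $\mathcal{S}$ of dyadic rectangles in $\mathbb{R}^2$ with sides parallel to the axes.
   Context: A dyadic interval is an interval $[j2^n,(j+1)2^n)$ with $j,n\in\mathbb{Z}$. A dyadic rectangle in $\mathbb{R}^2$ is a product $R=I\times J$ of two dyadic intervals (of possibly different lengths). $|R|$ denotes Lebesgue measure, $\langle h\rangle_R=\frac{1}{|R|}\int_R h$, and $\langle u,v\rangle=\int uv$. The dyadic strong maximal function is $\mathcal{M}_Sf(x)=\sup_{R\ni x}\langle |f|\rangle_R$, the supremum being over all dyadic rectangles $R$ containing $x$. A collection $\mathcal{S}$ of sets is $\eta$-sparse if for every $R\in\mathcal{S}$ there is a (measurable) subset $E(R)\subseteq R$ with $|E(R)|\ge\eta|R|$ such that the sets $E(R)$, $R\in\mathcal{S}$, are pairwise disjoint. *)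

(* Defs.v *)
From HB Require Import structures.
From mathcomp Require Import all_boot all_order all_algebra.
From mathcomp Require Import all_classical all_reals all_analysis.

Set Implicit Arguments.
Unset Strict Implicit.
Unset Printing Implicit Defensive.
Import Order.TTheory GRing.Theory Num.Theory.
Import numFieldNormedType.Exports.
Local Open Scope classical_set_scope.
Local Open Scope ring_scope.
Local Open Scope ereal_scope.

(* Lebesgue measure on R^2, defined on the Borel sets. *)
Definition leb2 (R : realType) :
    {measure set (measurableTypeR R * measurableTypeR R)%type -> \bar R}
  := @lebesgue_measure R \x @lebesgue_measure R.

Definition dyadic_interval (R : realType) : set (set R) :=
  [set I | exists j n : int,
     I = `[ j%:~R * (2 : R) ^ n, (j + 1)%:~R * (2 : R) ^ n [%classic%R].

Definition dyadic_rectangle (R : realType) : set (set (R * R)) :=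
  [set Q | exists I J : set R,
     [/\ dyadic_interval I, dyadic_interval J & Q = I `*` J]].

Definition average (R : realType) (h : R * R -> R) (Q : set (R * R)) : \bar R :=
  (leb2 R Q)^-1 * \int[leb2 R]_(x in Q) (h x)%:E.

Definition strong_maximal (R : realType) (f : R * R -> R) (x : R * R) : \bar R :=
  ereal_sup [set average (fun y => `|f y|%R) Q
            | Q in [set Q | dyadic_rectangle Q /\ Q x]].

(* The first argument is extended real-valued because a maximal function
   can take the value +oo. *)
Definition pairing (R : realType) (u : R * R -> \bar R) (v : R * R -> R)
  : \bar R := \int[leb2 R]_x (u x * (v x)%:E).

(* Needed because [integral] is total: when the positive and negative parts both
   have infinite integral, it returns oo - oo = -oo. *)
Definition pairing_defined (R : realType) (u : R * R -> \bar R)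
  (v : R * R -> R) : Prop :=
  (leb2 R).-integrable setT (fun x => u x * (v x)%:E).

(* Requiring the witnesses E(Q) to be Borel rather than Lebesgue measurable is
   no restriction: shrinking them by null sets changes no condition. *)
Definition sparse (R : realType) (eta : R) (S : set (set (R * R))) : Prop :=
  exists E : set (R * R) -> set (R * R),
    (forall Q, S Q ->
       [/\ measurable (E Q), E Q `<=` Q & eta%:E * leb2 R Q <= leb2 R (E Q)]) /\
    trivIset S E.

Definition compactly_supported (R : realType) (f : R * R -> R) : Prop :=
  compact (closure [set x | f x != 0%R]).

(* Main.v *)
Require Import Defs.
From HB Require Import structures.
From mathcomp Require Import finmap.
From mathcomp Require Import all_boot all_order all_algebra.
From mathcomp Require Import zify ring.
From mathcomp Require Import all_classical all_reals all_analysis.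
From mathcomp Require Import measurable_realfun.

Set Implicit Arguments.
Unset Strict Implicit.
Unset Printing Implicit Defensive.
Import Order.TTheory GRing.Theory Num.Theory.
Import numFieldNormedType.Exports.

(** Cut the unit square into dyadic cells of side 2^-m, m = k 4^k. Let f be the
    indicator of the Hammersley net F, which pairs each column i with the row
    whose binary digits are those of i in reverse order: F meets every dyadic
    subrectangle of area 2^-m exactly once. Let g count the nets G_s, s < 4^k,
    obtained from F by flipping every digit of the row except those of the s-th
    block of k consecutive positions.

    A dyadic rectangle of sides 2^-a, 2^-b with a + b > m fixes the digits of a
    row and of a column on a common window of a + b - m positions. It can meet
    both F and G_s only if this window lies inside block s. Hence s is unique,
    a + b - m <= k, and <f>_Q <g>_Q never exceeds kappa = 4^k / 4^m, its value on
    the unit square; sparse sums are therefore at most 4 kappa / eta. On the other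
    hand, if the window is exactly block s, the rectangle of area 2^-(m+k) around
    a cell of G_s does contain a cell of F, so the maximal function of f is at
    least 2^(k-m) there and its pairing with g is at least 2^k kappa. *)

(** * Binary digits of natural numbers *)

Definition bit (i t : nat) : bool := odd (i %/ 2 ^ t).

Fixpoint nat_of_bits (n : nat) (d : nat -> bool) : nat :=
  if n is n'.+1 then d 0 + (nat_of_bits n' (fun t => d t.+1)).*2 else 0.

Lemma nat_of_bits_lt n d : nat_of_bits n d < 2 ^ n.
Proof.
elim: n d => [//|n IHn] d /=; have := IHn (fun t => d t.+1).
by rewrite expnS; case: (d 0) => /=; lia.
Qed.

Lemma bitS i t : bit i t.+1 = bit i./2 t.
Proof. by rewrite /bit expnS divnMA divn2. Qed.

Lemma bit_nat_of_bits n d t : t < n -> bit (nat_of_bits n d) t = d t.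
Proof.
elim: n d t => [//|n IHn] d [|t] /=.
  by rewrite /bit expn0 divn1 oddD odd_double addbF oddb.
rewrite ltnS => tn; rewrite bitS.
have -> : (d 0 + (nat_of_bits n (fun t => d t.+1)).*2)./2 = nat_of_bits n (fun t => d t.+1).
  by rewrite half_bit_double.
exact: IHn.
Qed.

Lemma bit_inj n i j : i < 2 ^ n -> j < 2 ^ n ->
  (forall t, t < n -> bit i t = bit j t) -> i = j.
Proof.
elim: n i j => [|n IHn] i j; first by rewrite expn0; lia.
rewrite expnS => im jm ij.
have := ij 0 isT; rewrite /bit expn0 !divn1 => odd_ij.
rewrite -[i]odd_double_half -[j]odd_double_half odd_ij; congr (_ + _.*2).
apply: IHn; [lia|lia|] => t tn.
by rewrite -!bitS; exact: ij.
Qed.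

Lemma bit_divn i e t : bit (i %/ 2 ^ e) t = bit i (e + t).
Proof. by rewrite /bit -divnMA -expnD. Qed.

Lemma bit_modn i e t : t < e -> bit (i %% 2 ^ e) t = bit i t.
Proof.
move=> te; rewrite /bit [in RHS](divn_eq i (2 ^ e)).
have -> : 2 ^ e = 2 ^ (e - t) * 2 ^ t by rewrite -expnD subnK// ltnW.
rewrite mulnA divnMDl ?expn_gt0// oddD oddM oddX orbF.
by rewrite (_ : e - t == 0 = false) ?andbF//; lia.
Qed.

Lemma eq_divn_bits n e i j : i < 2 ^ n -> j < 2 ^ n ->
  (forall t, e <= t -> t < n -> bit i t = bit j t) ->
  i %/ 2 ^ e = j %/ 2 ^ e.
Proof.
move=> im jm ij; apply: (@bit_inj (n - e)) => [||t tn].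
- have [en|ne] := leqP e n; first by rewrite ltn_divLR ?expn_gt0// -expnD subnK.
  by rewrite divn_small ?expn_gt0//; apply: leq_trans im _; rewrite leq_exp2l// ltnW.
- have [en|ne] := leqP e n; first by rewrite ltn_divLR ?expn_gt0// -expnD subnK.
  by rewrite divn_small ?expn_gt0//; apply: leq_trans jm _; rewrite leq_exp2l// ltnW.
- by rewrite !bit_divn; apply: ij; lia.
Qed.
Lemma bit_eq_divn e i j t : i %/ 2 ^ e = j %/ 2 ^ e -> e <= t -> bit i t = bit j t.
Proof. by move=> ij et; rewrite -(subnKC et) -!bit_divn ij. Qed.

(** * Twisted digit reversals and point counts of nets in dyadic rectangles *)

(** Column digit [t] becomes row digit [m - t.+1], flipped when [d t] holds. The zero twist gives
    the net [F], the twist [off_block k s] gives [G_s]. *)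
Definition twisted_rev (m : nat) (d : nat -> bool) (i : nat) : nat :=
  nat_of_bits m (fun u => bit i (m - u.+1) (+) d (m - u.+1)).

Lemma bit_twisted_rev m d i t : t < m ->
  bit (twisted_rev m d i) (m - t.+1) = bit i t (+) d t.
Proof. by move=> tm; rewrite bit_nat_of_bits; [congr (bit _ _ (+) d _)|]; lia. Qed.

Lemma twisted_rev_lt m d i : twisted_rev m d i < 2 ^ m.
Proof. exact: nat_of_bits_lt. Qed.

(** Net points in the dyadic rectangle of sides [2^-a], [2^-b] with indices [x], [y]: dividing by
    [2 ^ (m - a)] keeps the top [a] digits, which name the ancestor of level [a]. *)
Definition net_count m d a x b y : nat :=
  \sum_(i < 2 ^ m)
    ((i %/ 2 ^ (m - a) == x) && (twisted_rev m d i %/ 2 ^ (m - b) == y)).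

(** [x] fixes the column digits from [m - a] up; [y] fixes the top row digits, hence the column
    digits below [b]. Only the positions in [[b, m - a)] stay free, and none if [a + b >= m], where
    the truncated exponent is 0. *)
Lemma net_count_le m d a x b y : a <= m -> b <= m ->
  net_count m d a x b y <= 2 ^ (m - (a + b)).
Proof.
move=> am bm; rewrite /net_count -big_mkcond sum1_card /=.
set A := (X in #|X|); set e := m - (a + b).
have e_gt0 : 0 < 2 ^ e by rewrite expn_gt0.
pose h (i : 'I_(2 ^ m)) : 'I_(2 ^ e) :=
  Ordinal (ltn_pmod (i %/ 2 ^ b) e_gt0).
rewrite -[leqRHS]card_ord; apply: (@leq_card_in _ _ h) => i j.
rewrite !unfold_in /A /= => /andP[/eqP ix /eqP iy] /andP[/eqP jx /eqP jy] /(congr1 val)/= hij.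
apply/val_inj/(@bit_inj m); [exact: ltn_ord|exact: ltn_ord|] => t tm.
have [mat|tma] := leqP (m - a) t.
  by apply: (@bit_eq_divn (m - a)) => //; rewrite ix jx.
have [tb|bt] := ltnP t b.
  apply: (can_inj (addbK (d t))); rewrite -!(@bit_twisted_rev m d)//.
  by apply: (@bit_eq_divn (m - b)); [rewrite iy jy|exact: leq_sub2l].
rewrite -(subnKC bt) -!bit_divn -[LHS](@bit_modn _ e) -1?[RHS](@bit_modn _ e) ?hij//.
all: move: tma bt; clear; rewrite /e; lia.
Qed.

(** A position in the window [[m - a, b)] is read twice, from [x] untwisted and from [y] twisted, so
    their sum reveals the twist. Two nets meeting the same rectangle thus have equal twists on the
    window. *)
Lemma net_count_compat m d a x b y t : 0 < net_count m d a x b y ->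
  m - a <= t -> t < b -> t < m -> a <= m -> b <= m ->
  d t = bit x (t - (m - a)) (+) bit y (b - t.+1).
Proof.
rewrite /net_count lt0n sum_nat_eq0 negb_forall => /existsP[i]/=.
rewrite eqb0 negbK => /andP[/eqP <- /eqP <-] mat tb tm am bm.
rewrite !bit_divn subnKC//.
have -> : m - b + (b - t.+1) = m - t.+1 by lia.
by rewrite bit_twisted_rev// addKb.
Qed.

Definition off_block (k s t : nat) : bool := t %/ k != s.

(** This is the bound of the product of averages by kappa, cleared of denominators: an average is a
    count times [2^(a+b) / 4^m]. *)
Lemma net_count_mul_le k a x b y :
  let m := k * 4 ^ k in
  0 < k -> a <= m -> b <= m ->
  net_count m (fun=> false) a x b y
    * (\sum_(s < 4 ^ k) net_count m (off_block k s) a x b y) * 4 ^ (a + b) <= 4 ^ k * 4 ^ m.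
Proof.
move=> m k0 am bm.
have [abm|mab] := leqP (a + b) m.
  apply: (@leq_trans (2 ^ (m - (a + b)) * (4 ^ k * 2 ^ (m - (a + b))) * 4 ^ (a + b))).
    rewrite leq_mul2r; apply/orP; right; apply: leq_mul; first exact: net_count_le.
    rewrite -[X in X * _]card_ord -sum_nat_const; apply: leq_sum => i _; exact: net_count_le.
  rewrite mulnCA -mulnA -expnMn -[2 * 2]/4 -expnD subnK//.
have N1 d : net_count m d a x b y <= 1.
  by rewrite (leq_trans (net_count_le _ _ _ _ _))// (_ : m - (a + b) = 0)//; lia.
case: (posnP (net_count m (fun=> false) a x b y)) => [->|N0]; first by rewrite !mul0n.
(* Meeting both nets forces the window [m - a, b) of common digits into block s. *)
have offN t s : 0 < net_count m (off_block k s) a x b y -> m - a <= t -> t < b -> t %/ k = s.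
  move=> Ns mat tb.
  have tm : t < m by lia.
  have := net_count_compat Ns mat tb tm am bm.
  by rewrite -(net_count_compat N0 mat tb tm am bm) => /negbFE/eqP.
have Slt : \sum_(s < 4 ^ k) net_count m (off_block k s) a x b y <= 1.
  (* The window is nonempty since [a + b > m]; the block of its first position is the only candidate
     for [s]. *)
  set s0 := (m - a) %/ k.
  apply: (@leq_trans (\sum_(s < 4 ^ k) (val s == s0))).
    apply: leq_sum => s _; case: (posnP (net_count m (off_block k s) a x b y)) => [->//|Ns].
    have -> : val s == s0 by apply/eqP/esym/offN => //; lia.
    exact: N1.
  rewrite -big_mkcond sum1_card; apply/card_le1P => i; rewrite !unfold_in /= => /eqP ii j.
  rewrite !unfold_in /=; apply/eqP/eqP => [jj|->//].
  by apply/val_inj; rewrite /= ii jj.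
case: (posnP (\sum_(s < 4 ^ k) net_count m (off_block k s) a x b y)) => [->|].
  by rewrite muln0 mul0n.
rewrite lt0n sum_nat_eq0 negb_forall => /existsP[s]/=; rewrite -lt0n => Ns.
(* A longer window would contain both [m - a] and [m - a + k], which lie in consecutive blocks. *)
have abk : a + b - m <= k.
  rewrite leqNgt; apply/negP => kab.
  have h1 := offN (m - a) s Ns (leqnn _) _.
  have h2 := offN (m - a + k) s Ns (leq_addr _ _) _.
  have : (m - a + k) %/ k = (m - a) %/ k by rewrite h1 ?h2//; lia.
  by rewrite divnDr ?dvdnn// divnn k0; lia.
apply: (@leq_trans (1 * 1 * 4 ^ (a + b))).
  by rewrite leq_mul2r; apply/orP; right; apply: leq_mul => //; exact: N1.
by rewrite !mul1n -expnD leq_exp2l//; lia.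
Qed.

(** With these [a] and [b] the window [[m - a, b)] is exactly block [s], where the twist vanishes,
    so [F] and [G_s] are compatible there. *)
Lemma net_hit k s i : let m := k * 4 ^ k in
  let a := m - s * k in let b := s.+1 * k in
  0 < k -> s < 4 ^ k -> i < 2 ^ m ->
  0 < net_count m (fun=> false) a (i %/ 2 ^ (m - a)) b
        (twisted_rev m (off_block k s) i %/ 2 ^ (m - b)).
Proof.
move=> m a b k0 sk im.
have sm : s * k + k <= m by rewrite -mulSnr mulnC leq_mul2l sk orbT.
(* Flipping the digits of [i] below block [s] imitates the twist there; the digits from [s * k] up,
   which determine the column ancestor, are kept. *)
pose j := nat_of_bits m (fun t => bit i t (+) ((t < s * k) && off_block k s t)).
have jm : j < 2 ^ m := nat_of_bits_lt _ _.
rewrite /net_count (bigD1 (Ordinal jm))//= ltn_addr//.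
rewrite (_ : _ && _)// ; apply/andP; split; apply/eqP/(@eq_divn_bits m) => //.
- move=> t at_ tm; rewrite bit_nat_of_bits// (_ : t < s * k = false) ?addbF//.
  by rewrite /a in at_; lia.
- exact: twisted_rev_lt.
- exact: twisted_rev_lt.
move=> t bt tm.
have -> : t = m - (m - t.+1).+1 by lia.
rewrite !bit_twisted_rev ?bit_nat_of_bits; try lia.
rewrite addbF; congr (_ (+) _).
set u := m - t.+1; have ub : u < s.+1 * k by rewrite /b in bt; lia.
case: ltnP => //= su; rewrite /off_block; apply/esym/negbTE; rewrite negbK eqn_leq.
by rewrite leq_divRL// su andbT -ltnS ltn_divLR.
Qed.

Local Open Scope classical_set_scope.
Local Open Scope ring_scope.
Local Open Scope ereal_scope.

(** * Grid cells and traces of dyadic intervals on the grid *)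

Definition grid (R : realType) (m i : nat) : set R :=
  `[i%:R / 2 ^+ m, i.+1%:R / 2 ^+ m[%classic%R.
Arguments grid : clear implicits.

Section grid.
Variable R : realType.
Implicit Types (m i q j a p x : nat) (I : set R) (y : R).
Local Open Scope ring_scope.
Local Notation leb := (@lebesgue_measure R).

Let exp2_gt0 n : 0 < 2 ^+ n :> R. Proof. by rewrite exprn_gt0. Qed.

Lemma gridP m i y : grid R m i y <-> i%:R <= y * 2 ^+ m < i.+1%:R.
Proof. by rewrite /grid /= in_itv /= ler_pdivrMr// ltr_pdivlMr. Qed.

Lemma lebesgue_measure_grid m i : leb (grid R m i) = (2 ^- m)%:E.
Proof.
rewrite /grid lebesgue_measure_itv/= lte_fin ltr_pM2r ?invr_gt0// ltr_nat ltnSn.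
by rewrite -EFinD -mulrBl -natrB// subSnn mul1r.
Qed.

Lemma measurable_grid m i : measurable (grid R m i).
Proof. exact: measurable_itv. Qed.

Lemma dyadic_grid m i : dyadic_interval (grid R m i).
Proof. 
exists i%:Z, (- m%:Z); rewrite /grid -exprnN.
by have -> : (i%:Z + 1)%:~R = i.+1%:R :> R by rewrite -addn1.
 Qed.

Lemma grid_divn m i q j y : (q <= m)%N ->
  grid R m i y -> grid R q j y -> (i %/ 2 ^ (m - q))%N = j.
Proof.
move=> qm /gridP/andP[iy yi] /gridP/andP[jy yj].
have y2m : y * 2 ^+ m = y * 2 ^+ q * 2 ^+ (m - q).
  by rewrite -mulrA -exprD subnKC.
have h1 : (j * 2 ^ (m - q) < i.+1)%N.
  rewrite -(ltr_nat R) (le_lt_trans _ yi)// y2m natrM natrX.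
  by rewrite ler_pM2r.
have h2 : (i < j.+1 * 2 ^ (m - q))%N.
  rewrite -(ltr_nat R) (le_lt_trans iy)// y2m natrM natrX.
  by rewrite ltr_pM2r.
apply/eqP; rewrite eqn_leq leq_divRL ?expn_gt0// -ltnS.
by rewrite ltn_divLR ?expn_gt0// h2 -ltnS.
Qed.

Lemma grid_unit m i y : (i < 2 ^ m)%N -> grid R m i y -> 0 <= y < 1.
Proof.
move=> im /gridP/andP[iy yi]; rewrite -(pmulr_lge0 _ (exp2_gt0 m)).
rewrite (le_trans _ iy)//= -(ltr_pM2r (exp2_gt0 m)) mul1r (lt_le_trans yi)//.
by rewrite -natrX ler_nat.
Qed.

Lemma grid_sub_unit m i : (i < 2 ^ m)%N -> grid R m i `<=` `[0, 2 ^+ 0[%classic.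
Proof. by move=> im y /(grid_unit im); rewrite expr0 /= in_itv. Qed.

(* A dyadic interval that meets the unit interval is [0, 2^p) or a grid cell.
   Either way it sits in [0, 2^p) and its trace on the grid of level m is that of
   a cell of some level a <= m. *)
Lemma dyadic_interval_grid m I : dyadic_interval I ->
  (forall i, (i < 2 ^ m)%N -> grid R m i `&` I = set0) \/
  exists a x p, [/\ (a <= m)%N, I `<=` `[0, 2 ^+ p[%classic &
    forall i, (i < 2 ^ m)%N -> (leb (grid R m i `&` I) <=
      ((i %/ 2 ^ (m - a) == x)%N%:R * 2 ^+ a / (2 ^+ m * 2 ^+ p))%:E * leb I)%E].
Proof.
move=> dI; have mI : measurable I by case: dI => j [n ->]; exact: measurable_itv.
have [|] := pselect (exists i, (i < 2 ^ m)%N /\ grid R m i `&` I !=set0); last first.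
  move=> H; left => i im; apply/eqP/negPn/negP => /set0P ne; apply: H; by exists i.
move=> [i0 [i0m [y [yi yI]]]]; right.
have /andP[y0 y1] := grid_unit i0m yi.
have leE i K : measurable K -> K `<=` grid R m i -> (leb K <= (2 ^- m)%:E)%E.
  move=> mK Ki; rewrite -(lebesgue_measure_grid m i).
  by apply: le_measure; rewrite ?inE//; exact: measurable_grid.
(* For a nonnegative exponent the length is at least 1, so an interval meeting the unit interval
   must start at 0. *)
case: dI => j [[q|q] IE].
  have j0 : j = 0.
    move: yI; rewrite IE /= in_itv/= => /andP[jy yj].
    have q0 : 0 < (2 : R) ^ q by rewrite exprz_gt0.
    have q1 : 1 <= (2 : R) ^ q by rewrite -exprnP exprn_ege1// ler1n.
    have : j%:~R * (2 : R) ^ q < 2 ^ q by rewrite (le_lt_trans jy)// (lt_le_trans y1).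
    rewrite gtr_pMl// -[1]/(1%:~R) ltr_int => j1.
    have : 0 < (j + 1)%:~R * (2 : R) ^ q by rewrite (le_lt_trans y0).
    by rewrite pmulr_lgt0// ltr0z; lia.
  rewrite j0 mul0r add0r mul1r -exprnP in IE.
  (* At level 0 every cell has ancestor 0, and the factor is the ratio of lengths [2^-m / 2^q]. *)
  exists 0%N, 0%N, q; split => //; first by rewrite IE.
  move=> i im; rewrite IE subn0 divn_small// eqxx lebesgue_measure_itv/= lte_fin exp2_gt0.
  rewrite EFinN sube0 -EFinM mul1r expr0 mul1r invfM mulfVK ?gt_eqF//.
  by apply: (leE i); [apply: measurableI => //; exact: measurable_grid|exact: subIsetl].
(* [Negz q] denotes the exponent [- q.+1]. *)
set q' := q.+1.
have {}IE : I = `[j%:~R / 2 ^+ q', (j + 1)%:~R / 2 ^+ q'[%classic.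
  by rewrite IE NegzE exprnN.
have {IE} : exists2 l, (l < 2 ^ q')%N & I = grid R q' l.
  move: yI; rewrite IE /= in_itv/= ler_pdivrMr// ltr_pdivlMr// => /andP[jy yj].
  have : (0 : R) < (j + 1)%:~R by rewrite (le_lt_trans _ yj)// mulr_ge0// ltW.
  rewrite ltr0z => j0; case: j j0 jy yj {IE} => [l|l] j0 jy yj; last by lia.
  exists l; last by rewrite /grid -[(l + 1)%:~R]/((l + 1)%:R) addn1.
  rewrite -(ltr_nat R) (le_lt_trans jy)// natrX gtr_pMl//.
(* A cell no finer than the grid keeps its own level. A finer one meets only its ancestor of level
   [m], with factor 1. *)
move=> [l lq IE]; have [qm|mq] := leqP q' m.
  exists q', l, 0%N; split => //; first by rewrite IE; exact: grid_sub_unit.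
  move=> i im; have [->|/set0P[z [zi zI]]] := eqVneq (grid R m i `&` I) set0.
    by rewrite measure0 mule_ge0// lee_fin divr_ge0// mulr_ge0// ltW.
  rewrite IE in zI *; rewrite (grid_divn qm zi zI) eqxx lebesgue_measure_grid -EFinM.
  rewrite expr0 mulr1 mul1r mulrAC divff ?gt_eqF// mul1r.
  apply: (leE i); last exact: subIsetl.
  by apply: measurableI; exact: measurable_grid.
exists m, (l %/ 2 ^ (q' - m))%N, 0%N; split => //; first by rewrite IE; exact: grid_sub_unit.
move=> i im; have [->|/set0P[z [zi zI]]] := eqVneq (grid R m i `&` I) set0.
  by rewrite measure0 mule_ge0// lee_fin divr_ge0// mulr_ge0// ltW.
rewrite IE in zI *; rewrite (grid_divn (ltnW mq) zI zi) subnn expn0 divn1 eqxx.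
rewrite expr0 mulr1 mul1r divff ?gt_eqF// mul1e.
by apply: le_measure; rewrite ?inE;
  [apply: measurableI| |]; exact: measurable_grid || exact: subIsetr.
Qed.

End grid.

(** * Measurability and measure of dyadic rectangles *)

Section dyadic_rectangle.
Variable R : realType.
Local Notation leb := (@lebesgue_measure R).

Lemma measurable_dyadic_interval (I : set R) : dyadic_interval I -> measurable I.
Proof. by case=> j [n ->]; exact: measurable_itv. Qed.

Lemma lebesgue_measure_dyadic (I : set R) : dyadic_interval I ->
  exists2 r : R, (0 < r)%R & leb I = r%:E.
Proof.
case=> j [n ->]; exists (2 ^ n)%R; first by rewrite exprz_gt0.
rewrite lebesgue_measure_itv/= lte_fin ltr_pM2r ?exprz_gt0// ltr_int ltzD1 lexx.
by rewrite -EFinD -mulrBl -rmorphB/= addrC addKr mul1r.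
Qed.

Lemma leb2_setX (I J : set R) : measurable I -> measurable J ->
  leb2 R (I `*` J) = leb I * leb J.
Proof. by move=> mI mJ; exact: product_measure1E. Qed.

Lemma measurable_dyadic_rectangle (Q : set (R * R)) : dyadic_rectangle Q ->
  measurable (Q : set (measurableTypeR R * measurableTypeR R)).
Proof.
by case=> I [J [dI dJ ->]]; apply: measurableX; exact: measurable_dyadic_interval.
Qed.

Lemma leb2_dyadic (Q : set (R * R)) : dyadic_rectangle Q ->
  exists2 r : R, (0 < r)%R & leb2 R Q = r%:E.
Proof.
case=> I [J [dI dJ ->]].
have [r r0 rI] := lebesgue_measure_dyadic dI.
have [s s0 sJ] := lebesgue_measure_dyadic dJ.
exists (r * s)%R; first exact: mulr_gt0.
by rewrite leb2_setX ?rI ?sJ ?EFinM//; exact: measurable_dyadic_interval.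
Qed.

End dyadic_rectangle.

(** * Sums of indicators of cells, their integrals and averages *)

Definition cell (R : realType) (m : nat) (e : nat * nat) : set (R * R) :=
  grid R m e.1 `*` grid R m e.2.
Arguments cell : clear implicits.

(** Cells count with multiplicity, so integrals are plain sums over the index type and [c] need not
    be shown injective. *)
Definition cells (R : realType) (m : nat) (K : finType) (c : K -> nat * nat)
  (x : R * R) : R := (\sum_k \1_(cell R m (c k)) x)%R.
Arguments cells : clear implicits.

Section cells.
Variables (R : realType) (m : nat) (K : finType) (c : K -> nat * nat).
Local Notation T := (measurableTypeR R * measurableTypeR R)%type.
Local Notation h := (cells R m K c).

Lemma dyadic_cell e : dyadic_rectangle (cell R m e).
Proof. by exists (grid R m e.1), (grid R m e.2); split => //; exact: dyadic_grid. Qed.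

Lemma measurable_cell e : measurable (cell R m e : set T).
Proof. by apply: measurable_dyadic_rectangle; exact: dyadic_cell. Qed.

Lemma leb2_cell e : leb2 R (cell R m e) = (4 ^- m)%:E.
Proof.
rewrite /cell leb2_setX ?lebesgue_measure_grid; [|exact: measurable_grid..].
by rewrite -EFinM -invfM -exprMn -natrM.
Qed.

Lemma cells_ge0 x : (0 <= h x)%R.
Proof. by apply: sumr_ge0 => k _; rewrite indicE. Qed.

Lemma norm_cells : (fun x => `|h x|%R) = h.
Proof. by apply/funext => x; rewrite ger0_norm// cells_ge0. Qed.

Lemma measurable_cells : measurable_fun setT (h : T -> R).
Proof.
apply: measurable_sum => k; apply: measurable_realfun.measurable_indic; exact: measurable_cell.
Qed.

Lemma integral_cells (Q : set T) : measurable Q ->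
  \int[leb2 R]_(x in Q) (h x)%:E = \sum_k leb2 R (cell R m (c k) `&` Q).
Proof.
move=> mQ; under eq_integral do rewrite /cells -sumEFin.
rewrite ge0_integral_sum//=.
- by apply: eq_bigr => k _; rewrite integral_indic//; exact: measurable_cell.
- move=> k; apply/measurable_EFinP/measurable_indic; exact: measurable_cell.
Qed.

Lemma integral_cellsT : \int[leb2 R]_x (h x)%:E = (#|K|%:R / 4 ^+ m)%:E.
Proof.
rewrite integral_cells//; under eq_bigr do rewrite setIT leb2_cell.
by rewrite sumEFin sumr_const mulr_natl.
Qed.

Lemma integrable_cells : (leb2 R).-integrable setT (EFin \o h).
Proof.
apply/integrableP; split; first by apply/measurable_EFinP; exact: measurable_cells.
under eq_integral => x _ do rewrite /= ger0_norm ?cells_ge0//.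
by rewrite integral_cellsT ltry.
Qed.

Lemma compactly_supported_cells :
  (forall k, (c k).1 < 2 ^ m)%N -> (forall k, (c k).2 < 2 ^ m)%N ->
  compactly_supported h.
Proof.
move=> c1 c2; rewrite /compactly_supported.
have cA : compact (`[(0:R)%R, (1:R)%R]%classic `*` `[(0:R)%R, (1:R)%R]%classic).
  by apply: compact_setX; exact: segment_compact.
apply: (subclosed_compact _ cA); first exact: closed_closure.
have clA : closed (`[(0:R)%R, (1:R)%R]%classic `*` `[(0:R)%R, (1:R)%R]%classic).
  apply: compact_closed cA; exact: (@norm_hausdorff R (R * R)%type).
move: clA => /closure_id ->; apply: closureS.
move=> x /eqP /psumr_neq0P []; first by move=> k _; rewrite indicE.
move=> k; rewrite indicE /= ltr0n lt0b => /set_mem[x1 x2].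
have /andP[? ?] := grid_unit (c1 k) x1; have /andP[? ?] := grid_unit (c2 k) x2.
by split; rewrite /= in_itv/=; apply/andP; split => //; exact: ltW.
Qed.

End cells.

Section average_cells.
Variables (R : realType) (m : nat) (K : finType) (c : K -> nat * nat).
Local Notation leb := (@lebesgue_measure R).

Lemma average_cells_eq0 (Q : set (R * R)) : dyadic_rectangle Q ->
  (forall k, cell R m (c k) `&` Q = set0) ->
  average (cells R m K c) Q = 0.
Proof.
move=> dQ Q0; rewrite /average integral_cells; last exact: measurable_dyadic_rectangle.
by rewrite big1 ?mule0// => k _; rewrite Q0 measure0.
Qed.

Lemma average_cells_ge0 (Q : set (R * R)) : dyadic_rectangle Q ->
  0 <= average (cells R m K c) Q.
Proof.
move=> dQ; rewrite /average mule_ge0 ?inve_ge0 ?measure_ge0//.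
by apply: integral_ge0 => x _; rewrite lee_fin cells_ge0.
Qed.

(** The trace of a cell on [I * J] is a product set, so the one-dimensional bounds multiply; the
    products of their indicators sum to a point count. *)
Lemma average_cells_le (I J : set R) (a b x y : nat) (u v : R) :
  dyadic_interval I -> dyadic_interval J -> (0 <= u)%R -> (0 <= v)%R ->
  (forall k, leb (grid R m (c k).1 `&` I) <=
    (((c k).1 %/ 2 ^ (m - a) == x)%N%:R * u)%:E * leb I) ->
  (forall k, leb (grid R m (c k).2 `&` J) <=
    (((c k).2 %/ 2 ^ (m - b) == y)%N%:R * v)%:E * leb J) ->
  average (cells R m K c) (I `*` J) <=
    ((\sum_k (((c k).1 %/ 2 ^ (m - a) == x) && ((c k).2 %/ 2 ^ (m - b) == y)))%N%:R
     * (u * v))%:E.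
Proof.
move=> dI dJ u0 v0 cI cJ.
have mI := measurable_dyadic_interval dI; have mJ := measurable_dyadic_interval dJ.
have [r r0 rI] := lebesgue_measure_dyadic dI.
have [s s0 sJ] := lebesgue_measure_dyadic dJ.
rewrite /average leb2_setX// rI sJ -EFinM inver gt_eqF ?mulr_gt0//.
rewrite integral_cells; last exact: measurableX.
rewrite natr_sum mulr_suml; pose w k : R := ((((c k).1 %/ 2 ^ (m - a) == x)
  && ((c k).2 %/ 2 ^ (m - b) == y))%N%:R * (u * v))%R.
apply: (@le_trans _ _ ((r * s)^-1%:E * \sum_k (w k * (r * s))%:E)).
  apply: lee_pmul => //.
  - by rewrite lee_fin invr_ge0 mulr_ge0// ltW.
  - exact: sume_ge0.
  apply: lee_sum => k _; rewrite /cell -setXI leb2_setX.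
  - apply: le_trans (lee_pmul _ _ (cI k) (cJ k)) _; rewrite ?measure_ge0//.
    rewrite rI sJ -!EFinM lee_fin /w -mulnb natrM.
    by rewrite le_eqVlt; apply/orP; left; apply/eqP; ring.
  - by apply: measurableI => //; exact: measurable_grid.
  - by apply: measurableI => //; exact: measurable_grid.
rewrite sumEFin -EFinM lee_fin -[X in (_ * X <= _)%R]mulr_suml mulrCA mulVf ?mulr1//.
by rewrite gt_eqF// mulr_gt0.
Qed.

End average_cells.

(** * The two nets and the product of their averages *)

Definition net (m : nat) (d : nat -> bool) (i : 'I_(2 ^ m)) : nat * nat :=
  (i : nat, twisted_rev m d i).

Definition nets (k m : nat) (u : 'I_(4 ^ k) * 'I_(2 ^ m)) : nat * nat :=
  net (off_block k u.1) u.2.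

(** Infinitely many dyadic rectangles contain the unit square; these boxes grade them by size so
    that the sum over all scales converges. *)
Definition box (R : realType) (p q : nat) : set (R * R) :=
  `[0%R, (2 ^+ p)%R[%classic `*` `[0%R, (2 ^+ q)%R[%classic.
Arguments box : clear implicits.

(** Both averages reduce to counts in the same rectangle. Stretching beyond the unit square divides
    each average by [2^(p+q)], hence the product by [4^(p+q)]. *)
Lemma net_average_mul_le (R : realType) (k : nat) (Q : set (R * R)) :
  let m := (k * 4 ^ k)%N in (0 < k)%N -> dyadic_rectangle Q ->
  let f := cells R m _ (@net m (fun=> false)) in
  let g := cells R m _ (@nets k m) in
  average f Q * average g Q = 0 \/
  exists p q : nat, Q `<=` box R p q /\
    average f Q * average g Q <= (4 ^+ k / 4 ^+ m / 4 ^+ (p + q))%:E.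
Proof.
move=> m k0 dQ f g; have [I [J [dI dJ QE]]] := dQ.
have ave0 : (forall e, (e.1 < 2 ^ m)%N -> (e.2 < 2 ^ m)%N ->
    cell R m e `&` Q = set0) -> average f Q * average g Q = 0.
  move=> Q0; rewrite /f average_cells_eq0 ?mul0e// => i.
  by apply: Q0; [exact: ltn_ord|exact: twisted_rev_lt].
case: (dyadic_interval_grid m dI) => [I0|[a [x [p [am Ip aI]]]]].
  left; apply: ave0 => e e1 _; rewrite QE /cell -setXI I0//.
  by rewrite set0X.
case: (dyadic_interval_grid m dJ) => [J0|[b [y [q [bm Jq bJ]]]]].
  left; apply: ave0 => e _ e2; rewrite QE /cell -setXI J0//.
  by rewrite setX0.
right; exists p, q; split; first by rewrite QE; exact: setSX.
set u : R := (2 ^+ a / (2 ^+ m * 2 ^+ p))%R.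
set v : R := (2 ^+ b / (2 ^+ m * 2 ^+ q))%R.
have u0 : (0 <= u)%R by rewrite divr_ge0// mulr_ge0.
have v0 : (0 <= v)%R by rewrite divr_ge0// mulr_ge0.
have fle : average f Q <= ((net_count m (fun=> false) a x b y)%:R * (u * v))%:E.
  rewrite QE; apply: average_cells_le => // i; rewrite /u /v mulrA.
    by apply: aI; exact: ltn_ord.
  by apply: bJ; exact: twisted_rev_lt.
have gle : average g Q <=
    ((\sum_(s < 4 ^ k) net_count m (off_block k s) a x b y)%N%:R * (u * v))%:E.
  rewrite /net_count pair_bigA/= QE; apply: average_cells_le => // i; rewrite /u /v mulrA.
    by apply: aI; exact: ltn_ord.
  by apply: bJ; exact: twisted_rev_lt.
apply: le_trans (lee_pmul _ _ fle gle) _; [exact: average_cells_ge0..|].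
rewrite -EFinM lee_fin.
have := net_count_mul_le x y k0 am bm.
set N1 := net_count _ _ _ _ _ _; set N2 := (\sum_(s < _) _)%N => N12.
have -> : (N1%:R * (u * v) * (N2%:R * (u * v)) =
    (N1 * N2 * 4 ^ (a + b))%N%:R / (4 ^+ m * 4 ^+ m * 4 ^+ (p + q)) :> R)%R.
  rewrite !natrM natrX /u /v !exprD (_ : 4%:R = 2 * 2 :> R)%R ?exprMn; last by rewrite -natrM.
  by field; rewrite !expf_neq0// pnatr_eq0.
rewrite ler_pdivrMr ?mulr_gt0 ?exprn_gt0//.
rewrite (_ : (_ / _ / _ * _ = (4 ^ k * 4 ^ m)%N%:R)%R) ?ler_nat//.
by rewrite natrM !natrX; field; rewrite !expf_neq0// pnatr_eq0.
Qed.

(** * Upper bound for sparse sums *)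

Section sparse_sum.
Variable R : realType.
Local Notation T := (measurableTypeR R * measurableTypeR R)%type.

Lemma measurable_box p q : measurable (box R p q : set T).
Proof. by apply: measurableX; exact: measurable_itv. Qed.

Lemma leb2_box p q : leb2 R (box R p q) = (2 ^+ (p + q))%:E.
Proof.
rewrite /box leb2_setX ?lebesgue_measure_itv/=; [|exact: measurable_itv..].
by rewrite !lte_fin !exprn_gt0// -!EFinD !subr0 -EFinM -exprD.
Qed.

Lemma sum_expr2V_le2 n : (\sum_(p < n) 2 ^- p <= 2 :> R)%R.
Proof.
suff -> : (\sum_(p < n) 2 ^- p = 2 - 2 / 2 ^+ n :> R)%R.
  by rewrite gerBl divr_ge0.
elim: n => [|n IHn]; first by rewrite big_ord0 expr0 divr1 subrr.
rewrite big_ord_recr/= IHn exprS; field.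
by rewrite expf_neq0 ?pnatr_eq0.
Qed.

(** Sparseness replaces the measure of [Q] by that of [E Q] over [eta]. The box of index [(p, q)]
    then contributes at most [kappa / eta * 2^-(p+q)], and two geometric series of sum at most 2
    give the 4. *)
Lemma sparse_sum_le (eta kappa : R) (S : set (set (R * R)))
    (w : set (R * R) -> \bar R) :
  (0 < eta)%R -> (0 <= kappa)%R -> S `<=` @dyadic_rectangle R -> sparse eta S ->
  (forall Q, S Q -> w Q = 0 \/ exists p q, Q `<=` box R p q /\
     w Q <= (kappa / 4 ^+ (p + q))%:E * leb2 R Q) ->
  \esum_(Q in S) w Q <= (4 * (kappa / eta))%:E.
Proof.
move=> eta0 kappa0 Sd [E [SE tE]] wS.
pose c (u : nat * nat) : R := (kappa / eta / 4 ^+ (u.1 + u.2))%R.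
have c0 u : (0 <= c u)%R by rewrite !divr_ge0// ltW.
have mE Q : S Q -> measurable (E Q) by case/SE.
have mEb Q u : S Q -> measurable (E Q `&` (box R u.1 u.2 : set T)).
  by move=> SQ; apply: measurableI; [exact: mE|exact: measurable_box].
(* One box index is chosen per [Q]; [(0, 0)] is a default when [w Q = 0] or [Q] is outside [S]. *)
have /choice[pq wpq] : forall Q, exists u, S Q ->
    w Q <= (c u)%:E * leb2 R (E Q `&` box R u.1 u.2).
  move=> Q; have [SQ|] := pselect (S Q); last by exists (0, 0)%N.
  case: (wS _ SQ) => [->|[p [q [Qb wQ]]]].
    by exists (0, 0)%N => _; rewrite mule_ge0// lee_fin.
  exists (p, q) => _ /=; apply: (le_trans wQ).
  have [_ EQ QE] := SE _ SQ.
  rewrite setIidl; last exact: subset_trans Qb.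
  rewrite [leRHS](_ : _ = (kappa / 4 ^+ (p + q))%:E * (eta^-1%:E * leb2 R (E Q))).
    apply: lee_wpmul2l; first by rewrite lee_fin divr_ge0.
    have [r r0 Qr] := leb2_dyadic (Sd _ SQ).
    rewrite Qr in QE *; rewrite -[leLHS]mul1e -(@mulVf _ eta) ?gt_eqF// EFinM -muleA.
    by apply: lee_wpmul2l => //; rewrite lee_fin invr_ge0 ltW.
  by rewrite muleA -EFinM /c /= mulrAC.
(* For fixed u the sets E Q are disjoint, so their traces on the box of index u
   have total measure at most 2^(u.1 + u.2); it remains to sum over u. *)
apply: ge_ereal_sup => _ [A [/finite_fsetP[X AX] AS] <-].
rewrite fsbig_finite ?AX// set_fsetK.
have XS Q : Q \in X -> S Q by move=> QX; apply: AS; rewrite AX.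
have [N XN] : exists N, forall Q, Q \in X -> ((pq Q).1 < N)%N /\ ((pq Q).2 < N)%N.
  exists (\max_(Q <- X) maxn (pq Q).1 (pq Q).2).+1 => Q QX.
  have := @leq_bigmax_seq _ (enum_fset X) xpredT (fun Q => maxn (pq Q).1 (pq Q).2) Q QX isT.
  by rewrite geq_max => /andP[].
pose v (u : 'I_N * 'I_N) : nat * nat := (u.1 : nat, u.2 : nat).
(* The single chosen index is enlarged to all [u] below [N], at the cost of nonnegative terms, so
   that the sums can be exchanged. *)
apply: (@le_trans _ _ (\sum_(Q <- X) \sum_(u : 'I_N * 'I_N)
    (c (v u))%:E * leb2 R (E Q `&` box R u.1 u.2))).
  rewrite !big_seq; apply: lee_sum => Q QX; apply: le_trans (wpq _ (XS _ QX)) _.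
  have [p1 p2] := XN _ QX.
  rewrite (bigD1 (Ordinal p1, Ordinal p2))//= /v /=.
  have -> : ((pq Q).1, (pq Q).2) = pq Q by case: (pq Q).
  by rewrite leeDl// sume_ge0// => u _; rewrite mule_ge0// lee_fin.
rewrite exchange_big/=.
apply: (@le_trans _ _ (\sum_(u : 'I_N * 'I_N)
    (kappa / eta * (2 ^- u.1 * 2 ^- u.2))%:E)).
  apply: lee_sum => u _; rewrite -ge0_sume_distrr; last by move=> Q _; exact: measure_ge0.
  rewrite -measure_fbigsetU; last 2 first.
  - by move=> Q QX; apply: (mEb Q (v u)); exact: XS.
  - apply: trivIset_setIr; apply: sub_trivIset tE => Q; exact: XS.
  apply: (@le_trans _ _ ((c (v u))%:E * leb2 R (box R u.1 u.2))).
    apply: lee_wpmul2l; first by rewrite lee_fin.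
    apply: le_measure; rewrite ?inE; last 2 first.
    - exact: measurable_box.
    - by rewrite -bigcup_seq; apply: bigcup_sub => Q _; exact: subIsetr.
    rewrite big_seq; apply: bigsetU_measurable => Q QX; apply: (mEb Q (v u)); exact: XS.
  rewrite leb2_box -EFinM lee_fin /c /v /= !exprD.
  rewrite (_ : 4 = 2 * 2 :> R)%R; last by rewrite -natrM.
  rewrite !exprMn le_eqVlt; apply/orP; left; apply/eqP; field.
  by rewrite !expf_neq0 ?pnatr_eq0// gt_eqF.
rewrite sumEFin lee_fin -mulr_sumr mulrC ler_wpM2r//; first by rewrite divr_ge0// ltW.
rewrite -(pair_bigA _ (fun i j : 'I_N => 2 ^- i * 2 ^- j)%R)/=.
rewrite -big_distrlr/= (_ : 4 = 2 * 2 :> R)%R; last by rewrite -natrM.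
by apply: ler_pM; rewrite ?sumr_ge0 ?sum_expr2V_le2// => i _; rewrite invr_ge0 exprn_ge0.
Qed.

End sparse_sum.

(** * The maximal function: measurability, integrability of the pairing, lower bounds *)

Section strong_maximal.
Variable R : realType.
Local Notation T := (measurableTypeR R * measurableTypeR R)%type.

Lemma strong_maximal_ge (h : R * R -> R) (Q : set (R * R)) (z : R * R) :
  dyadic_rectangle Q -> Q z ->
  average (fun y => `|h y|%R) Q <= strong_maximal h z.
Proof. by move=> dQ Qz; apply: ereal_sup_ubound; exists Q. Qed.

(** A superlevel set is the union of the dyadic rectangles whose average exceeds the level, and
    these are indexed by quadruples of integers. *)
Lemma measurable_strong_maximal (h : R * R -> R) :
  measurable_fun setT (strong_maximal h : T -> \bar R).
Proof.
move=> mT; apply: (measurability _ (ErealGenOInfty.measurableE R)) => //.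
move=> _ [_ [t ->] <-]; rewrite setTI.
pose Q (e : (int * int) * (int * int)) : set T :=
  `[e.1.1%:~R * (2 : R) ^ e.1.2, (e.1.1 + 1)%:~R * (2 : R) ^ e.1.2 [%classic%R `*`
  `[e.2.1%:~R * (2 : R) ^ e.2.2, (e.2.1 + 1)%:~R * (2 : R) ^ e.2.2 [%classic%R.
have dQ e : dyadic_rectangle (Q e).
  by eexists _, _; split; [eexists _, _; reflexivity..|reflexivity].
rewrite [X in measurable X](_ : _ =
    \bigcup_(e in [set e | t%:E < average (fun y => `|h y|%R) (Q e)]) Q e).
  rewrite bigcup_mkcond; apply: countable_bigcupT_measurable => // e.
  by case: ifP => // _; exact: measurable_dyadic_rectangle.
apply/seteqP; split => [z|z [e te Qz]] /=.
  rewrite in_itv/= andbT => /ereal_sup_gt[_ [_ [[I [J [[j [n ->]] [l [p ->]] ->]]] Qz] <-]] tQ.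
  by exists ((j, n), (l, p)).
by rewrite in_itv/= andbT (lt_le_trans te)// strong_maximal_ge.
Qed.

(** Each cell contributes at most 1 to any average. This crude bound serves to dominate the
    integrand of the pairing. *)
Lemma strong_maximal_cells_le m (K : finType) (c : K -> nat * nat) (z : R * R) :
  strong_maximal (cells R m K c) z <= #|K|%:R%:E.
Proof.
apply: ge_ereal_sup => _ [Q [dQ _] <-]; rewrite norm_cells /average.
have mQ := measurable_dyadic_rectangle dQ; have [r r0 Qr] := leb2_dyadic dQ.
rewrite integral_cells// Qr inver gt_eqF//.
apply: (@le_trans _ _ (r^-1%:E * \sum_(k : K) r%:E)).
  apply: lee_wpmul2l; first by rewrite lee_fin invr_ge0 ltW.
  apply: lee_sum => k _; rewrite -Qr; apply: le_measure; rewrite ?inE//.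
  by apply: measurableI => //; exact: measurable_cell.
by rewrite sumEFin sumr_const -EFinM lee_fin -[(r *+ _)%R]mulr_natl mulrCA
  mulVf ?mulr1// gt_eqF.
Qed.

(** An empty supremum would be [-oo], so a rectangle through [z] is exhibited: the unit square of
    the integer lattice. *)
Lemma strong_maximal_cells_ge0 m (K : finType) (c : K -> nat * nat) (z : R * R) :
  0 <= strong_maximal (cells R m K c) z.
Proof.
pose I (y : R) : set R := `[(Num.floor y)%:~R * 2 ^ (0 : int),
  (Num.floor y + 1)%:~R * 2 ^ (0 : int)[%classic%R.
have Iy y : I y y.
  by rewrite /I /= in_itv/= expr0z !mulr1 floor_itv.
have dI y : dyadic_interval (I y) by exists (Num.floor y), 0%R.
have dQ : dyadic_rectangle (I z.1 `*` I z.2) by exists (I z.1), (I z.2).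
apply: le_trans (strong_maximal_ge _ dQ _) => //.
by rewrite norm_cells; exact: average_cells_ge0.
Qed.

Lemma integrable_maximal_cells m (K L : finType) (c : K -> nat * nat) (d : L -> nat * nat) :
  pairing_defined (strong_maximal (cells R m K c)) (cells R m L d).
Proof.
rewrite /pairing_defined; apply: (@le_integrable _ T _ (leb2 R) setT measurableT _
   (fun x => #|K|%:R%:E * (EFin \o cells R m L d) x)).
- apply: emeasurable_funM; first exact: measurable_strong_maximal.
  by apply/measurable_EFinP; exact: measurable_cells.
- move=> x _; rewrite !gee0_abs /=.
  + by apply: lee_wpmul2r; [rewrite lee_fin cells_ge0|exact: strong_maximal_cells_le].
  + by rewrite mule_ge0// lee_fin cells_ge0.
  + by rewrite mule_ge0 ?strong_maximal_cells_ge0// lee_fin cells_ge0.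
- by apply: integrableZl => //; exact: integrable_cells.
Qed.

Lemma grid_sub m q i : (q <= m)%N -> grid R m i `<=` grid R q (i %/ 2 ^ (m - q)).
Proof.
move=> qm y /gridP/andP[iy yi]; apply/gridP.
have e0 : (0 < 2 ^+ (m - q) :> R)%R by rewrite exprn_gt0.
have y2m : (y * 2 ^+ m = y * 2 ^+ q * 2 ^+ (m - q))%R.
  by rewrite -mulrA -exprD subnKC.
rewrite y2m in iy yi; apply/andP; split.
  rewrite -(ler_pM2r e0) (le_trans _ iy)// -natrX -natrM ler_nat.
  exact: leq_divM.
by rewrite -(ltr_pM2r e0) (lt_le_trans yi)// -natrX -natrM ler_nat ltn_ceil// expn_gt0.
Qed.

(** The rectangle of [net_hit] around [z] has area [2^-(m+k)] and contains a whole cell of [F], of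
    area [4^-m]. *)
Lemma strong_maximal_net_ge (k : nat) (u : 'I_(4 ^ k) * 'I_(2 ^ (k * 4 ^ k)))
    (z : R * R) : let m := (k * 4 ^ k)%N in
  (0 < k)%N -> cell R m (nets u) z ->
  (2 ^+ k / 2 ^+ m)%:E <= strong_maximal (cells R m _ (@net m (fun=> false))) z.
Proof.
case: u => s i m k0 [/= z1 z2].
have := net_hit k0 (ltn_ord s) (ltn_ord i); rewrite -/m.
set a := (m - s * k)%N; set b := (s.+1 * k)%N.
have sm : (s * k + k <= m)%N by rewrite -mulSnr mulnC leq_mul2l ltn_ord orbT.
have am : (a <= m)%N by rewrite leq_subr.
have bm : (b <= m)%N by rewrite /b mulSnr.
have abE : (a + b = m + k)%N by rewrite /a /b mulSnr; lia.
rewrite /net_count lt0n sum_nat_eq0 negb_forall => /existsP[j]/=.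
rewrite eqb0 negbK => /andP[/eqP ja /eqP jb].
set Q := grid R a (i %/ 2 ^ (m - a)) `*`
  grid R b (twisted_rev m (off_block k s) i %/ 2 ^ (m - b)).
have dQ : dyadic_rectangle Q.
  by do 2 eexists; split; last reflexivity; exact: dyadic_grid.
have Qz : Q z by split; apply: grid_sub.
apply: le_trans (strong_maximal_ge _ dQ Qz).
have jQ : cell R m (net (fun=> false) j) `<=` Q.
  by move=> y [/= y1 y2]; split; rewrite /= -?ja -?jb; exact: grid_sub.
have Q2 : leb2 R Q = (2 ^- (m + k))%:E.
  rewrite /Q leb2_setX ?lebesgue_measure_grid; [|exact: measurable_grid..].
  by rewrite -EFinM -invfM -exprD abE.
rewrite norm_cells /average integral_cells; last exact: measurable_dyadic_rectangle.
rewrite Q2 inver gt_eqF ?invr_gt0 ?exprn_gt0// invrK (bigD1 j)//= setIidl//.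
rewrite leb2_cell.
apply: (@le_trans _ _ ((2 ^+ (m + k))%:E * (4 ^- m)%:E)).
  rewrite -EFinM lee_fin exprD (_ : 4 = 2 * 2 :> R)%R; last by rewrite -natrM.
  rewrite exprMn le_eqVlt; apply/orP; left; apply/eqP; field.
  by rewrite !expf_neq0 ?pnatr_eq0.
by apply: lee_wpmul2l; rewrite ?lee_fin ?exprn_ge0// leeDl// sume_ge0.
Qed.

(** The pointwise bound [2^k / 2^m] on the support of [g] is integrated against [g], whose integral
    is [4^k * 2^m / 4^m]. *)
Lemma pairing_net_ge (k : nat) : let m := (k * 4 ^ k)%N in (0 < k)%N ->
  (2 ^+ k * (4 ^+ k / 4 ^+ m))%:E <=
  pairing (strong_maximal (cells R m _ (@net m (fun=> false)))) (cells R m _ (@nets k m)).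
Proof.
move=> m k0; set f := cells _ _ _ _; set g := cells _ _ _ _.
have mg : measurable_fun setT (EFin \o g : T -> \bar R).
  by apply/measurable_EFinP; exact: measurable_cells.
have -> : (2 ^+ k * (4 ^+ k / 4 ^+ m))%:E =
    \int[leb2 R]_z ((2 ^+ k / 2 ^+ m)%:E * (g z)%:E).
  rewrite ge0_integralZl//; last by move=> z _; rewrite lee_fin cells_ge0.
  rewrite integral_cellsT card_prod !card_ord natrM !natrX -EFinM; congr EFin; field.
  by rewrite !expf_neq0 ?pnatr_eq0.
rewrite /pairing; apply: ge0_le_integral => //.
- by move=> z _; rewrite mule_ge0// lee_fin ?divr_ge0 ?exprn_ge0// cells_ge0.
- by apply: emeasurable_funM => //.
- by apply: emeasurable_funM => //; exact: measurable_strong_maximal.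
move=> z _; have [->|] := eqVneq (g z) 0%R; first by rewrite !mule0.
move=> /eqP /psumr_neq0P []; first by move=> u _; rewrite indicE.
move=> u; rewrite indicE /= ltr0n lt0b => /set_mem uz.
apply: lee_wpmul2r; first by rewrite lee_fin cells_ge0.
exact: strong_maximal_net_ge uz.
Qed.

End strong_maximal.

(** * Choice of [k] and comparison of the pairing with sparse sums *)

Theorem theorem1 (R : realType) (C eta : R)
    (C_gt0 : (0 < C)%R) (eta_gt0 : (0 < eta)%R) (eta_lt1 : (eta < 1)%R) :
  exists f g : R * R -> R,
    [/\ compactly_supported f /\ (leb2 R).-integrable setT (EFin \o f),
        compactly_supported g /\ (leb2 R).-integrable setT (EFin \o g),
        pairing_defined (strong_maximal f) g &
        forall S : set (set (R * R)),
          S `<=` @dyadic_rectangle R -> sparse eta S ->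
          C%:E * (\esum_(Q in S) (average (fun x => `|f x|%R) Q
                                  * average (fun x => `|g x|%R) Q
                                  * leb2 R Q)%E)%R
          < `| pairing (strong_maximal f) g | ].
Proof.
(* The pairing is at least [2^k * kappa] and sparse sums are at most [4 * kappa / eta], so
   [2^k > 4 * C / eta] suffices; taking [k = n.+1] keeps [k] positive. *)
have [n Cn] : exists n : nat, (4 * C / eta < n%:R)%R.
  by exists (Num.bound (4 * C / eta)); rewrite archi_boundP// divr_ge0 ?mulr_ge0// ltW.
pose k := n.+1; pose m := (k * 4 ^ k)%N.
have Ck : (C * (4 / eta) < 2 ^+ k)%R.
  rewrite mulrCA mulrA (lt_trans Cn)// -natrX ltr_nat.
  by rewrite (ltn_trans (ltnSn n))// ltn_expl.
pose f := cells R m _ (@net m (fun=> false)); pose g := cells R m _ (@nets k m).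
exists f, g; split.
- split; last exact: integrable_cells.
  by apply: compactly_supported_cells => i; [exact: ltn_ord|exact: twisted_rev_lt].
- split; last exact: integrable_cells.
  by apply: compactly_supported_cells => -[s i]; [exact: ltn_ord|exact: twisted_rev_lt].
- exact: integrable_maximal_cells.
move=> S Sd Ssp; set kappa : R := (4 ^+ k / 4 ^+ m)%R.
have kappa_gt0 : (0 < kappa)%R by rewrite divr_gt0// exprn_gt0.
have Sle : \esum_(Q in S) (average (fun x => `|f x|%R) Q
    * average (fun x => `|g x|%R) Q * leb2 R Q) <= (4 * (kappa / eta))%:E.
  apply: sparse_sum_le Ssp _ => //; first exact: ltW.
  move=> Q SQ; rewrite !norm_cells.
  have [->|[p [q [Qb fg]]]] := net_average_mul_le (ltn0Sn n) (Sd _ SQ).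
    by left; rewrite mul0e.
  by right; exists p, q; split => //; apply: lee_wpmul2r.
apply: (@le_lt_trans _ _ (C%:E * (4 * (kappa / eta))%:E)).
  by apply: lee_wpmul2l Sle; rewrite lee_fin ltW.
apply: lt_le_trans (lee_abs _); apply: lt_le_trans (pairing_net_ge R (ltn0Sn n)).
rewrite -EFinM lte_fin -[ltRHS]/(2 ^+ k * kappa)%R.
have -> : (C * (4 * (kappa / eta)) = C * (4 / eta) * kappa)%R.
  by field; rewrite gt_eqF.
by rewrite ltr_pM2r.
Qed.
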